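(* Suppose the step size parameters $\mathcal A_k$ (realizations $\alpha_k$) generated by the adaptive stochastic algorithm satisfy the step-size assumption (i)–(ii) stated in the context, with constants $\gamma\in(0,1)$, $\bar\alpha>0$ and $p\in(\tfrac12,1)$, and let $q=1-p$. Let $T_\varepsilon$ be the stopping time. Then for every positive integer $n$ and every $\omega>0$, with probability at least $1-n^{-\omega}-c\,n^{-(1+\omega)}$, where $c=\frac{2\sqrt{pq}}{(1-2\sqrt{pq})^2}$, we have $$\text{either } T_\varepsilon<n\quad\text{or}\quad \min_{1\le k\le n}\alpha_k\ \ge\ \alpha^*(n):=\bar\alpha\,\gamma\,\gamma^{(1+\omega)\log_{1/(2q)}n}=\bar\alpha\,\gamma\, n^{-(1+\omega)\log_{1/(2q)}(1/\gamma)} .$$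
   Context: Algorithmic framework. To minimize $\phi:\mathbb R^m\to\mathbb R$, an adaptive stochastic algorithm with parameters $\gamma\in(0,1)$, $\alpha_{\max}\in(0,\infty)$ and deterministic $x_0$, $\alpha_0\in(0,\alpha_{\max}]$ generates random iterates $X_k$ and random step size parameters $\mathcal A_k>0$ (realizations $x_k$, $\alpha_k$), $k\ge 0$, $\mathcal A_0=\alpha_0$. At iteration $k$ stochastic oracles are used to compute a trial point $x_k^+=x_k+s_k(\alpha_k)$ and to decide whether the step is successful. If successful, $x_{k+1}=x_k^+$ and $\alpha_{k+1}=\min\{\gamma^{-1}\alpha_k,\alpha_{\max}\}$; otherwise $x_{k+1}=x_k$ and $\alpha_{k+1}=\gamma\alpha_k$. $(\mathcal F_k)$ denotes the filtration generated by the algorithm up to iteration $k$ ($X_k$ and $\mathcal A_k$ are $\mathcal F_k$-measurable). Stopping time. For $\varepsilon>0$, $T_\varepsilon$ is the first $k$ at which a specified optimality condition holds: $T_\varepsilon=\min\{k:\|\nabla\phi(X_k)\|\le\varepsilon\}$ for non-convex $\phi$, and $T_\varepsilon=\min\{k:\phi(X_k)-\inf\phi\le\varepsilon\}$ for strongly convex $\phi$. It is a stopping time with respect to $(\mathcal F_k)$, possibly infinite. Step-size assumption. (i) For all $k\ge1$, $\mathcal A_k\in\{\gamma\mathcal A_{k-1},\ \min\{\alpha_{\max},\gamma^{-1}\mathcal A_{k-1}\}\}$. (ii) There are constants $\bar\alpha>0$ and $p>\frac12$ such that for all $k$, $\mathbb P(\mathcal A_{k+1}=\gamma^{-1}\mathcal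 A_k\mid\mathcal F_k)\ge p$ almost surely on the event $\{k<T_\varepsilon,\ \mathcal A_k\le\bar\alpha\}$. Standing convention: $\alpha_0\ge\bar\alpha$. *)

(* Defs.v *)
From HB Require Import structures.
From mathcomp Require Import all_boot all_order all_algebra.
From mathcomp Require Import all_classical all_reals all_analysis.

Set Implicit Arguments.
Unset Strict Implicit.
Unset Printing Implicit Defensive.

Import Order.TTheory GRing.Theory Num.Theory.
Import numFieldNormedType.Exports.

Local Open Scope classical_set_scope.
Local Open Scope ring_scope.

(* The library norm on ['rV[R]_m] is the max norm, hence this definition. *)
Definition norm2 (R : realType) (m : nat) (v : 'rV[R]_m) : R :=
  Num.sqrt (\sum_(i < m) v ord0 i ^+ 2).

Definition gradient (R : realType) (m : nat) (phi : 'rV[R]_m -> R)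
    (x : 'rV[R]_m) : 'rV[R]_m :=
  \row_(i < m) 'D_(delta_mx ord0 i) phi x.

Definition strongly_convex (R : realType) (m : nat) (phi : 'rV[R]_m -> R) :=
  exists2 mu : R, 0 < mu &
    forall (x y : 'rV[R]_m) (t : R), 0 <= t <= 1 ->
      phi (t *: x + (1 - t) *: y) <=
        t * phi x + (1 - t) * phi y
        - mu / 2 * (t * (1 - t)) * norm2 (x - y) ^+ 2.

(* [NonConvex] stands for "not assumed convex". *)
Variant problem_class := NonConvex | StronglyConvex.

Definition admissible_objective (R : realType) (m : nat) (cls : problem_class)
    (phi : 'rV[R]_m -> R) : Prop :=
  match cls with
  | NonConvex => forall x, differentiable phi x
  | StronglyConvex => strongly_convex phi
  end.

Definition optimality_condition (R : realType) (m : nat) (cls : problem_class)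
    (phi : 'rV[R]_m -> R) (eps : R) (x : 'rV[R]_m) : Prop :=
  match cls with
  | NonConvex => norm2 (gradient phi x) <= eps
  | StronglyConvex => phi x - inf (range phi) <= eps
  end.

Section stochastic.
Context (d : measure_display) (Omega : measurableType d) (R : realType).

Definition filtration (F : nat -> set (set Omega)) : Prop :=
  [/\ forall k, sigma_algebra setT (F k),
      forall k, F k `<=` measurable
    & forall j k, (j <= k)%N -> F j `<=` F k].

(* [G] is a sub-sigma-algebra, given as a set of events. *)
Definition measurable_wrt (G : set (set Omega)) (f : Omega -> R) : Prop :=
  forall U : set R, measurable U -> G (f @^-1` U).

(* [g] is a version of the conditional probability P(E | G). *)
Definition is_cond_prob (P : probability Omega R) (G : set (set Omega))
    (E : set Omega) (g : Omega -> R) : Prop :=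
  [/\ measurable_wrt G g,
      P.-integrable setT (EFin \o g)
    & forall B, G B -> (\int[P]_(w in B) (g w)%:E = P (E `&` B))%E].

(* Random times take values in \bar R, with +oo for "never". *)
Definition stopping_time (F : nat -> set (set Omega)) (T : Omega -> \bar R) :=
  forall k : nat, F k [set w | (T w <= k%:R%:E)%E].

(* First [k] with [C (X k w)]; it is +oo when there is none, since the
   infimum of the empty set is +oo. *)
Definition first_time (S : Type) (C : S -> Prop) (X : nat -> Omega -> S)
    (w : Omega) : \bar R :=
  ereal_inf [set (k%:R)%:E | k in [set k : nat | C (X k w)]].

(* [s k (A k w) w] is the step tried at iteration [k] and [success k] the event
   that it is accepted; the oracles that determine them are left arbitrary. The
   filtration may carry the oracles' randomness, so it is only required that
   the iterates and step sizes are adapted to it. Measurability of a vector is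
   that of its coordinates. *)
Record adaptive_algorithm (m : nat) (gamma alpha_max : R)
    (x0 : 'rV[R]_m) (alpha0 : R) (F : nat -> set (set Omega))
    (X : nat -> Omega -> 'rV[R]_m) (A : nat -> Omega -> R)
    (s : nat -> R -> Omega -> 'rV[R]_m) (success : nat -> set Omega) : Prop := {
  alg_gamma : 0 < gamma < 1 ;
  alg_alpha_max : 0 < alpha_max ;
  alg_alpha0 : 0 < alpha0 <= alpha_max ;
  alg_filtration : filtration F ;
  alg_X_adapted : forall k i, measurable_wrt (F k) (fun w => X k w ord0 i) ;
  alg_A_adapted : forall k, measurable_wrt (F k) (A k) ;
  alg_X_init : forall w, X 0%N w = x0 ;
  alg_A_init : forall w, A 0%N w = alpha0 ;
  alg_success : forall k w, success k w ->
    X k.+1 w = X k w + s k (A k w) w /\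
    A k.+1 w = Num.min (gamma^-1 * A k w) alpha_max ;
  alg_failure : forall k w, ~ success k w ->
    X k.+1 w = X k w /\ A k.+1 w = gamma * A k w
}.

Definition step_size_dynamics (gamma alpha_max : R) (A : nat -> Omega -> R) :=
  forall k w, (1 <= k)%N ->
    A k w = gamma * A k.-1 w \/
    A k w = Num.min alpha_max (gamma^-1 * A k.-1 w).

Definition step_size_increase (P : probability Omega R)
    (F : nat -> set (set Omega)) (gamma alpha_bar p : R)
    (A : nat -> Omega -> R) (T : Omega -> \bar R) :=
  forall k : nat, exists2 g : Omega -> R,
    is_cond_prob P (F k) [set w | A k.+1 w = gamma^-1 * A k w] g &
    {ae P, forall w, (k%:R%:E < T w)%E -> A k w <= alpha_bar -> p <= g w}.

End stochastic.

Definition log_base (R : realType) (b x : R) : R := ln x / ln b.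

Definition alpha_star (R : realType) (alpha_bar gamma q omega : R) (n : nat) :=
  alpha_bar * gamma *
    gamma `^ ((1 + omega) * log_base (1 / (2 * q)) n%:R).

(* Main.v *)
Require Import Defs.
From HB Require Import structures.
From mathcomp Require Import all_boot all_order all_algebra.
From mathcomp Require Import all_classical all_reals all_analysis.
From mathcomp Require Import measurable_realfun lra ring.

Import Order.TTheory GRing.Theory Num.Theory.
Import numFieldNormedType.Exports.

Local Open Scope classical_set_scope.
Local Open Scope ring_scope.

(* Put [r := p / q] and let the potential of a step size [a] be
   [(a / alpha_bar) ^ -theta], where [theta] is such that [gamma ^ -theta = r].
   Before the stopping time the potential is a supermartingale while the step
   size is at most [alpha_bar], and gains at most [r - 1] per step otherwise.
   Stopping at the first step size below [alpha_star], where the potential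
   equals [r * r ^ L] with [L := (1 + omega) * log_(1/(2q)) n], Markov's
   inequality bounds the probability of such a step size by
   [(1 + n (r - 1)) / (r * r ^ L) <= n * r ^ -L], and [r >= 1 / (2 q)] bounds
   this by [n * n ^ -(1 + omega) = n ^ -omega]. *)

(** * Events of a sub-sigma-algebra and conditional probability *)

Lemma sigma_algebra_setC {T : Type} {G : set (set T)} {B : set T} :
  sigma_algebra setT G -> G B -> G (~` B).
Proof. by case=> _ GC _ /GC; rewrite setTD. Qed.

Lemma sigma_algebra_setI {T : Type} {G : set (set T)} {B C : set T} :
  sigma_algebra setT G -> G B -> G C -> G (B `&` C).
Proof. by move=> /(sigma_algebraP (fun _ _ => @subsetT _ _))[_ _ _]; apply. Qed.

Lemma cond_prob_lower_bound (d : measure_display) (Omega : measurableType d)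
    (R : realType) (P : probability Omega R) (G : set (set Omega))
    (E B : set Omega) (g : Omega -> R) (p : R) :
  G `<=` measurable -> is_cond_prob P G E g -> G B ->
  0 <= p -> {ae P, forall w, B w -> p <= g w} -> (p%:E * P B <= P (E `&` B))%E.
Proof.
move=> Gm [gG gint gE] GB p0 pg; rewrite -(gE _ GB) -(integral_cst P (Gm _ GB)).
have mg : measurable_fun B g.
  apply: (measurable_funS measurableT) => //.
  by case/integrableP: gint => /measurable_EFinP.
(* The bound [p <= g] holds only almost everywhere on [B]. The maximum with [p] changes [g] there
   only on a null set and makes the bound hold pointwise, as monotonicity of the integral
   requires. *)
have mm : measurable_fun B (fun w => (Num.max (g w) p)%:E).
  apply/measurable_EFinP; exact: measurable_maxr.
rewrite (@ae_eq_integral _ _ _ P B (fun w => (Num.max (g w) p)%:E)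
  (EFin \o g))//.
- apply: ge0_le_integral => //; first exact: Gm.
  + by move=> w _; rewrite lee_fin le_max lexx orbT.
- exact: Gm.
- exact/measurable_EFinP.
- by apply: filterS pg => w pgw Bw /=; rewrite max_l // pgw.
Qed.

(* The exponent is the one for which scaling [a] by [gamma] scales the
   potential by [r]. *)
Definition potential {R : realType} (gamma alpha_bar r a : R) : R :=
  (a / alpha_bar) `^ (- (ln r / - ln gamma)).

(** * Scaling and monotonicity of the potential *)

Section potential_theory.
Context {R : realType} {gamma alpha_bar r : R}.
Hypotheses (gamma01 : 0 < gamma < 1) (bar_gt0 : 0 < alpha_bar) (r_gt1 : 1 < r).

Local Notation V := (potential gamma alpha_bar r).

Lemma potential_ge0 a : 0 <= V a. Proof. exact: powR_ge0. Qed.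

Lemma powR_scale_potential x :
  (gamma `^ x) `^ (- (ln r / - ln gamma)) = r `^ x.
Proof.
have [g0 g1] := andP gamma01.
have lg : ln gamma < 0 by rewrite ln_lt0// g0.
rewrite -powRrM /powR gt_eqF// gt_eqF ?(lt_trans ltr01)//.
by congr expR; field; rewrite lt_eqF.
Qed.

(** A real exponent [x] covers both the single steps, with [x] equal to 1 or -1, and the power of
    [gamma] in [alpha_star]. *)
Lemma potential_mul x a : 0 < a -> V (gamma `^ x * a) = r `^ x * V a.
Proof.
have [g0 g1] := andP gamma01.
move=> a0; rewrite /potential -mulrA powRM ?powR_scale_potential// ?powR_ge0//.
by rewrite divr_ge0// ltW.
Qed.

Lemma potential_bar : V alpha_bar = 1.
Proof. by rewrite /potential divff ?powR1// gt_eqF. Qed.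

Lemma potential_down a : 0 < a -> V (gamma * a) = r * V a.
Proof.
have [g0 g1] := andP gamma01.
have r0 : 0 < r by exact: lt_trans r_gt1.
by move=> /(potential_mul 1); rewrite !powRr1 ?ltW.
Qed.

Lemma potential_up a : 0 < a -> V (gamma^-1 * a) = r^-1 * V a.
Proof.
have [g0 g1] := andP gamma01.
have r0 : 0 < r by exact: lt_trans r_gt1.
by move=> /(potential_mul (-1)); rewrite !powR_inv1 ?ltW.
Qed.

Lemma potential_anti a b : 0 < a -> a <= b -> V b <= V a.
Proof.
have [g0 g1] := andP gamma01.
move=> a0 ab; have b0 := lt_le_trans a0 ab.
rewrite /potential !powRN lef_pV2 ?posrE ?powR_gt0 ?divr_gt0//.
rewrite ge0_ler_powR ?nnegrE ?divr_ge0 ?(ltW a0) ?(ltW b0) ?(ltW bar_gt0)//.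
  by rewrite ltW// ln_gt0.
  by rewrite oppr_ge0 ltW// ln_lt0// g0.
by rewrite ler_pM2r ?invr_gt0.
Qed.

End potential_theory.

Lemma measurable_potential (R : realType) (gamma alpha_bar r : R) :
  measurable_fun setT (potential gamma alpha_bar r).
Proof.
apply: (measurableT_comp (measurable_powR _)).
exact: measurable_funM.
Qed.

(** * Pathwise bounds and measurability of the step sizes *)

Section step_sizes.
Context {d : measure_display} {Omega : measurableType d} {R : realType}.
Context {P : probability Omega R} {F : nat -> set (set Omega)}.
Context {gamma alpha_max alpha0 alpha_bar p q : R}.
Context {A : nat -> Omega -> R} {T : Omega -> \bar R}.
Hypothesis gamma01 : 0 < gamma < 1.
Hypothesis alpha_max_gt0 : 0 < alpha_max.
Hypothesis F_filtration : filtration F.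
Hypothesis A_adapted : forall k, measurable_wrt (F k) (A k).
Hypothesis T_stopping : stopping_time F T.
Hypothesis alpha_bar_gt0 : 0 < alpha_bar.
Hypothesis p_range : 1 / 2 < p < 1.
Hypothesis qE : q = 1 - p.
Hypothesis A_init : forall w, A 0%N w = alpha0.
Hypothesis alpha0_range : alpha_bar <= alpha0 <= alpha_max.
Hypothesis A_dynamics : step_size_dynamics gamma alpha_max A.
Hypothesis A_increase : step_size_increase P F gamma alpha_bar p A T.

Local Notation r := (p / q).
Local Notation V := (potential gamma alpha_bar r).

Lemma odds_gt1 : 1 < r.
Proof.
by have [? ?] := andP p_range; rewrite ltr_pdivlMr ?mul1r qE; lra.
Qed.

Lemma step_size_range k w : 0 < A k w <= alpha_max.
Proof.
have [g0 g1] := andP gamma01; have [b0 am] := andP alpha0_range.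
elim: k => [|k /andP[Ak0 Akm]].
  by rewrite A_init am andbT (lt_le_trans alpha_bar_gt0).
have [] := A_dynamics k.+1 w isT => /= ->.
  by rewrite mulr_gt0//= (le_trans _ Akm)// ler_piMl// ltW.
by rewrite ge_min lexx andbT lt_min alpha_max_gt0 mulr_gt0 ?invr_gt0.
Qed.

Lemma step_size_gt0 k w : 0 < A k w.
Proof. by have /andP[] := step_size_range k w. Qed.

Lemma step_size_ge k w : gamma * A k w <= A k.+1 w.
Proof.
have [g0 g1] := andP gamma01; have /andP[Ak0 Akm] := step_size_range k w.
have gA : gamma * A k w <= A k w by rewrite ler_piMl// ltW.
have [] := A_dynamics k.+1 w isT => /= ->; first exact: lexx.
rewrite le_min (le_trans gA Akm) (le_trans gA)// ler_peMl ?(ltW Ak0)//.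
by rewrite invf_ge1// ltW.
Qed.

(** The initial value is deterministic and each step has two possible outcomes, so finitely many
    values can occur at time [k]. Events can then be cut into finitely many slices on which [A k] is
    constant. *)
Lemma step_size_values k : exists s : seq R, forall w, A k w \in s.
Proof.
elim: k => [|k [s As]].
  by exists [:: alpha0] => w; rewrite A_init mem_head.
exists ([seq gamma * u | u <- s] ++
        [seq Num.min alpha_max (gamma^-1 * u) | u <- s]) => w.
rewrite mem_cat; have [] := A_dynamics k.+1 w isT => /= ->.
  by rewrite (map_f (fun u => gamma * u) (As w)).
by rewrite (map_f (fun u => Num.min alpha_max (gamma^-1 * u)) (As w)) orbT.
Qed.

Lemma measurable_step_size k : measurable_fun setT (A k).
Proof.
have [_ Fm _] := F_filtration.
by move=> _ Y mY; rewrite setTI; apply: (Fm k); apply: A_adapted.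
Qed.

Lemma measurable_potential_step_size k B :
  measurable_fun B (fun w => (V (A k w))%:E).
Proof.
apply: (measurable_funS measurableT) => //; apply/measurable_EFinP.
exact: measurableT_comp (measurable_potential _ _ _ _) (measurable_step_size k).
Qed.

Lemma potential_step k w : V (A k.+1 w) <= r * V (A k w).
Proof.
have [g0 _] := andP gamma01; have A0 := step_size_gt0 k w.
rewrite -(potential_down gamma01 alpha_bar_gt0 odds_gt1)//.
by rewrite (potential_anti gamma01 alpha_bar_gt0 odds_gt1) ?mulr_gt0// step_size_ge.
Qed.

(** * Expected change of the potential in one step *)

Lemma integral_potential_le k (B : set Omega) (c : R) :
  measurable B -> (forall w, B w -> V (A k w) <= c) ->
  (\int[P]_(w in B) (V (A k w))%:E <= c%:E * P B)%E.
Proof.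
move=> mB Vc; rewrite -integral_cst//; apply: ge0_le_integral => //.
- by move=> w _; rewrite lee_fin potential_ge0.
- exact: measurable_potential_step_size.
Qed.

(* Below [alpha_bar] the potential is a supermartingale because
   [p / r + q * r = 1]; above it the potential is at most [1], so one step
   raises it by at most [r - 1]. *)
Lemma slice_drift k u (B : set Omega) :
  F k B -> (forall w, B w -> (k%:R%:E < T w)%E) -> (forall w, B w -> A k w = u) ->
  (\int[P]_(w in B) (V (A k.+1 w))%:E <= (V u + (r - 1))%:E * P B)%E.
Proof.
have [_ Fm _] := F_filtration; have r1 := odds_gt1.
have [p12 p1] := andP p_range; have [g0 g1] := andP gamma01.
move=> FB BT Bu; have mB := Fm _ _ FB.
have Pfin C : measurable C -> P C = (fine (P C))%:E.
  by move=> mC; rewrite fineK// fin_num_measure.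
have V0 : 0 <= V u by exact: potential_ge0.
have Vstep w : B w -> V (A k.+1 w) <= r * V u.
  by move=> Bw; rewrite -(Bu _ Bw) potential_step.
have [u_bar|u_bar] := leP u alpha_bar; last first.
  apply: (le_trans (integral_potential_le _ _ (r * V u) mB Vstep)).
  have V1 : V u <= 1.
    rewrite -(potential_bar (gamma := gamma) (r := r) alpha_bar_gt0).
    by rewrite (potential_anti gamma01 alpha_bar_gt0 odds_gt1)// ltW.
  rewrite lee_wpmul2r ?measure_ge0// lee_fin; nra.
(* Positivity of [u] is read off a point of the slice, so the empty slice is treated apart. *)
have [->|/set0P[w0 Bw0]] := eqVneq B set0.
  by rewrite integral_set0 measure0 mule0.
have u0 : 0 < u by rewrite -(Bu _ Bw0) step_size_gt0.
have [g gE gp] := A_increase k.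
set U := A k.+1 @^-1` [set gamma^-1 * u].
have mU : measurable U.
  by rewrite -[U]setTI; apply: measurable_step_size => //; exact: measurable_set1.
have pU : (p%:E * P B <= P (B `&` U))%E.
  have -> : B `&` U = [set w | A k.+1 w = gamma^-1 * A k w] `&` B.
    rewrite setIC; apply/seteqP; split=> w [UA Bw]; split=> //=.
      by rewrite Bu.
    by rewrite /U/= UA Bu.
  apply: cond_prob_lower_bound (Fm k) gE FB _ _; first lra.
  by apply: filterS gp => w h Bw; apply: h; [exact: BT|rewrite Bu].
have mI : measurable (B `&` U) by exact: measurableI.
have mD : measurable (B `\` U) by exact: measurableD.
have -> : (\int[P]_(w in B) (V (A k.+1 w))%:E =
    \int[P]_(w in B `&` U) (V (A k.+1 w))%:E +
    \int[P]_(w in B `\` U) (V (A k.+1 w))%:E)%E.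
  rewrite -ge0_integral_setU ?setIDK//.
  - by congr integral; rewrite -setIUr setUv setIT.
  - exact: measurable_potential_step_size.
  - by move=> w _; rewrite lee_fin potential_ge0.
  - by apply/disj_set2P; rewrite setDE setIACA setICr setI0.
have iI : (\int[P]_(w in B `&` U) (V (A k.+1 w))%:E <=
    (r^-1 * V u)%:E * P (B `&` U))%E.
  apply: integral_potential_le => // w [Bw ->].
  by rewrite (potential_up gamma01 alpha_bar_gt0 odds_gt1).
have iD : (\int[P]_(w in B `\` U) (V (A k.+1 w))%:E <=
    (r * V u)%:E * P (B `\` U))%E.
  by apply: integral_potential_le => // w [Bw _]; exact: Vstep.
apply: (le_trans (leeD iI iD)).
have Dfin : P (B `\` U) = (fine (P B) - fine (P (B `&` U)))%:E.
  by rewrite measureD ?ltey_eq ?fin_num_measure// EFinB -!Pfin.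
rewrite Dfin; move: pU; rewrite (Pfin _ mB) (Pfin _ mI) -!EFinM -EFinD !lee_fin.
move: (fine (P (B `&` U))) => x.
have : 0 <= fine (P B) by rewrite fine_ge0.
move: (fine (P B)) => b b0 pbx.
have q0 : 0 < q by rewrite qE; lra.
have rq : r * q = p by rewrite divfK// gt_eqF.
have rp : r^-1 * p = q by rewrite invf_div divfK// gt_eqF//; lra.
have rV1 : r^-1 < 1 by rewrite invf_lt1; lra.
(* Here [b] is the probability of [B] and [x >= p * b] that of an increase within [B]. The left side
   decreases in [x], because [r^-1 < r], and equals [b] at [x = p * b]. *)
have h1 : r^-1 * x + r * (b - x) <= b.
  have -> : r^-1 * x + r * (b - x) =
    r * q * b + r^-1 * p * b - (r - r^-1) * (x - p * b) by rewrite qE; ring.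
  rewrite rq rp qE.
  have : 0 <= (r - r^-1) * (x - p * b) by rewrite mulr_ge0//; lra.
  by rewrite qE; lra.
rewrite [leLHS](_ : _ = V u * (r^-1 * x + r * (b - x))); last by rewrite /=; ring.
rewrite mulrDl (le_trans (ler_wpM2l V0 h1))// lerDl mulr_ge0//.
by rewrite subr_ge0 ltW.
Qed.

(** On each slice where [A k] is constant, [slice_drift] applies; the increments add up to
    [(r - 1) * P B], which is at most [r - 1]. *)
Lemma drift k (B : set Omega) :
  F k B -> (forall w, B w -> (k%:R%:E < T w)%E) ->
  (\int[P]_(w in B) (V (A k.+1 w))%:E <=
   \int[P]_(w in B) (V (A k w))%:E + (r - 1)%:E)%E.
Proof.
have [Fsig Fm _] := F_filtration; have r1 := odds_gt1.
move=> FB BT; have mB := Fm _ _ FB; have [s0 As0] := step_size_values k.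
(* Removing repetitions makes the slices pairwise disjoint, so that integrals over them add up. *)
pose s := undup s0; pose S u := B `&` A k @^-1` [set u].
have FS u : F k (S u).
  by apply: sigma_algebra_setI => //; apply: A_adapted; exact: measurable_set1.
have mS u : measurable (S u) by apply: (Fm k).
have BE : B = \big[setU/set0]_(u <- s) S u.
  rewrite -bigcup_seq; apply/seteqP; split=> [w Bw|w [u _ []]//].
  by exists (A k w) => //=; rewrite mem_undup.
have int_slices f : measurable_fun setT f -> (forall w, 0 <= f w)%E ->
    (\int[P]_(w in B) f w = \sum_(u <- s) \int[P]_(w in S u) f w)%E.
  move=> mf f0; rewrite {1}BE ge0_integral_bigsetU ?undup_uniq//.
    exact/trivIset_setIl/trivIset_preimage1.
  exact: measurable_funS mf.
have V0 j w : (0 <= (V (A j w))%:E)%E by rewrite lee_fin potential_ge0.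
have mV j := measurable_potential_step_size j setT.
have r10 : (0 <= (r - 1)%:E)%E by rewrite lee_fin subr_ge0 ltW.
apply: (@le_trans _ _ (\int[P]_(w in B) ((V (A k w))%:E + (r - 1)%:E))%E).
  rewrite !int_slices//; last by move=> w; rewrite adde_ge0.
    apply: lee_sum => u _.
    rewrite (_ : (\int[P]_(w in S u) ((V (A k w))%:E + (r - 1)%:E) =
       (V u + (r - 1))%:E * P (S u))%E); last first.
      by rewrite -(integral_cst P (mS u)); apply: eq_integral => w /set_mem[_ /= ->].
    by apply: slice_drift => // w [Bw Aw]//; exact: BT.
  exact: emeasurable_funD.
rewrite ge0_integralD//; last exact: measurable_potential_step_size.
rewrite leeD2l// integral_cst// -[leRHS]mule1 lee_wpmul2l//.
exact: probability_le1.
Qed.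

(** * Passage below a level before the stopping time *)

(** Stopping is encoded by shrinking the domain of integration instead of freezing the process: a
    path is dropped once [T] is reached or the level [a] is passed. *)
Definition active (a : R) (k : nat) : set Omega :=
  [set w | (k%:R%:E < T w)%E /\ forall j, (j <= k)%N -> a <= A j w].

(** The index is the last active time, so the indices below [n] account for first passages at times
    1 to [n]. *)
Definition crossing (a : R) (k : nat) : set Omega :=
  active a k `&` [set w | A k.+1 w < a].

Lemma active_adapted a k : F k (active a k).
Proof.
have [Fsig _ Fmono] := F_filtration.
have -> : active a k = ~` [set w | (T w <= k%:R%:E)%E] `&`
    [set w | forall j, (j <= k)%N -> a <= A j w].
  by apply/seteqP; split=> w [h1 h2]; split=> //=; move: h1 => /=;
    rewrite ?ltNge => /negP.
have Fge j : F j [set w | a <= A j w].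
  rewrite (_ : [set _ | _] = A j @^-1` `[a, +oo[); first exact: A_adapted.
  by apply/seteqP; split=> w /=; rewrite in_itv/= andbT.
apply: sigma_algebra_setI => //; first exact/sigma_algebra_setC/T_stopping.
elim: k => [|k IH].
  rewrite (_ : [set _ | _] = [set w | a <= A 0%N w])//.
  by apply/seteqP; split=> [w|w h [|]//]; apply.
rewrite (_ : [set _ | _] = [set w | forall j, (j <= k)%N -> a <= A j w] `&`
    [set w | a <= A k.+1 w]).
  by apply: sigma_algebra_setI => //; apply: Fmono IH.
apply/seteqP; split=> [w h|w [h1 h2] j]; last first.
  by rewrite leq_eqVlt ltnS => /predU1P[->//|]; exact: h1.
by split=> [j jk|]; apply: h => //; exact: leqW.
Qed.

Lemma measurable_active a k : measurable (active a k).
Proof. by have [_ Fm _] := F_filtration; exact: Fm (active_adapted a k). Qed.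

Lemma measurable_crossing a k : measurable (crossing a k).
Proof.
apply: measurableI; first exact: measurable_active.
rewrite (_ : [set _ | _] = A k.+1 @^-1` `]-oo, a[).
  by rewrite -[_ @^-1` _]setTI; exact: measurable_step_size.
by apply/seteqP; split=> w /=; rewrite in_itv.
Qed.

(** The events [crossing a k] and [active a k.+1] are disjoint parts of [active a k], where [drift]
    applies. On a crossing the new potential is at least [V a], as the potential decreases in the
    step size. *)
Lemma crossing_drift a k : 0 < a ->
  ((V a)%:E * P (crossing a k) + \int[P]_(w in active a k.+1) (V (A k.+1 w))%:E
   <= \int[P]_(w in active a k) (V (A k w))%:E + (r - 1)%:E)%E.
Proof.
move=> a0.
have V0 j w : (0 <= (V (A j w))%:E)%E by rewrite lee_fin potential_ge0.
have mV := measurable_potential_step_size.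
have [mA mC] := (measurable_active a, measurable_crossing a).
apply: (le_trans _ (drift _ _ (active_adapted a k) _)); last by move=> w [].
apply: (@le_trans _ _ (\int[P]_(w in crossing a k `|` active a k.+1)
    (V (A k.+1 w))%:E)%E).
  rewrite ge0_integral_setU//; last first.
    apply/disj_set2P/seteqP; split=> // w [[_ /= Aa] [_ /(_ _ (leqnn _))]].
    by rewrite leNgt Aa.
  rewrite leeD2r// -(integral_cst P (mC k)); apply: ge0_le_integral => //.
    by move=> w _; rewrite lee_fin potential_ge0.
  move=> w [_ /= /ltW Aa]; rewrite lee_fin.
  by rewrite (potential_anti gamma01 alpha_bar_gt0 odds_gt1)// step_size_gt0.
apply: ge0_subset_integral => //; first exact: measurableU.
move=> w [[]//|[kT h]]; split; last by move=> j jk; apply: h; exact: leqW.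
by apply: le_lt_trans kT; rewrite lee_fin ler_nat.
Qed.

(** Induction accumulates [crossing_drift]; the initial 1 bounds the potential of
    [alpha0 >= alpha_bar]. *)
Lemma sum_crossing_le a n : 0 < a ->
  (\sum_(k < n) (V a)%:E * P (crossing a k) +
     \int[P]_(w in active a n) (V (A n w))%:E <= (1 + n%:R * (r - 1))%:E)%E.
Proof.
move=> a0; have [b0 _] := andP alpha0_range.
elim: n => [|n IH].
  rewrite big_ord0 add0e mul0r addr0.
  apply: (le_trans (integral_potential_le _ _ 1 _ _)) => //.
  - exact: measurable_active.
  - move=> w _; rewrite A_init.
    rewrite -(potential_bar (gamma := gamma) (r := r) alpha_bar_gt0).
    by rewrite (potential_anti gamma01 alpha_bar_gt0 odds_gt1).
  - by rewrite mul1e probability_le1//; exact: measurable_active.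
rewrite big_ord_recr/= -addeA.
apply: (le_trans (leeD2l _ (crossing_drift a n a0))).
rewrite addeA (_ : 1 + _ = 1 + n%:R * (r - 1) + (r - 1)); last first.
  by rewrite -natr1; ring.
by rewrite [leRHS]EFinD leeD2r.
Qed.

Lemma probability_crossing_le a n : 0 < a ->
  ((V a)%:E * P (\big[setU/set0]_(k < n) crossing a k) <=
   (1 + n%:R * (r - 1))%:E)%E.
Proof.
move=> a0; apply: (le_trans _ (sum_crossing_le a n a0)).
apply: (@le_trans _ _ (\sum_(k < n) (V a)%:E * P (crossing a k))%E).
  rewrite -ge0_sume_distrr//; apply: lee_wpmul2l.
    by rewrite lee_fin potential_ge0.
  by apply: Boole_inequality => k _; exact: measurable_crossing.
by rewrite leeDl// integral_ge0// => w _; rewrite lee_fin potential_ge0.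
Qed.

(** A first time [k.+1] at which the step size is below [a] would put the path in [crossing a k],
    since [k < n <= T]. Time 0 is covered by [a <= alpha0]. *)
Lemma step_size_ge_of_no_crossing a n w : a <= alpha0 -> (n%:R%:E <= T w)%E ->
  ~ (\big[setU/set0]_(k < n) crossing a k) w ->
  forall k, (k <= n)%N -> a <= A k w.
Proof.
move=> a0 nT; rewrite -bigcup_mkord => nC.
elim/ltn_ind => -[_ _|k IH kn]; first by rewrite A_init.
rewrite leNgt; apply/negP => Aa; apply: nC; exists k => //; split=> //; split.
  by apply: lt_le_trans nT; rewrite lte_fin ltr_nat.
by move=> j jk; apply: IH => //; exact: leq_trans jk (ltnW kn).
Qed.

End step_sizes.

(** * Logarithms, hitting times and minima, and the final estimate *)

Lemma powR_log_base (R : realType) (b x y : R) : 0 < b -> b != 1 -> 0 < x ->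
  b `^ (y * log_base b x) = x `^ y.
Proof.
move=> b0 b1 x0; rewrite /powR !gt_eqF//; congr expR.
by rewrite -mulrA divfK// ln_eq0.
Qed.

Lemma alpha_starE (R : realType) (alpha_bar gamma q omega : R) (n : nat) :
  0 < gamma -> (0 < n)%N ->
  alpha_star alpha_bar gamma q omega n = alpha_bar * gamma *
    n%:R `^ (- ((1 + omega) * log_base (1 / (2 * q)) (1 / gamma))).
Proof.
move=> g0 n0; rewrite /alpha_star /log_base /powR gt_eqF// gt_eqF ?ltr0n//.
by congr (_ * expR _); rewrite [1 / gamma]div1r [ln gamma^-1]lnV ?posrE//; ring.
Qed.

(** A first time is an integer or infinite. This turns the strict inequality of the theorem into an
    event that the stopping-time property controls. *)
Lemma first_time_ltS (R : realType) (d : measure_display)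
    (Omega : measurableType d) (S : Type) (C : S -> Prop)
    (X : nat -> Omega -> S) (n : nat) (w : Omega) :
  (first_time R C X w < n.+1%:R%:E)%E = (first_time R C X w <= n%:R%:E)%E.
Proof.
apply/idP/idP => [/ereal_inf_lt[_ [k Ck <-]]|]; last first.
  by move=> /le_lt_trans; apply; rewrite lte_fin ltr_nat.
rewrite lte_fin ltr_nat ltnS => kn; apply: (@le_trans _ _ k%:R%:E).
  by apply: ereal_inf_lbound; exists k.
by rewrite lee_fin ler_nat.
Qed.

(** The default value [f 1] is itself one of the terms because [0 < n]. *)
Lemma le_bigmin_natP (R : realType) (a : R) (f : nat -> R) (n : nat) :
  (0 < n)%N ->
  (a <= \big[Num.min/f 1%N]_(1 <= k < n.+1) f k) <->
  (forall k, (0 < k <= n)%N -> a <= f k).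
Proof.
move=> n0; split=> [af k kn|af].
  by apply: (le_trans af); apply: ge_bigmin_seq => //; rewrite mem_index_iota.
rewrite big_seq_cond; apply: le_bigmin => [|k]; first by apply: af; rewrite n0.
by rewrite andbT mem_index_iota; exact: af.
Qed.

Theorem theorem1
  (R : realType) (d : measure_display) (Omega : measurableType d)
  (P : probability Omega R)
  (m : nat) (cls : problem_class) (phi : 'rV[R]_m -> R)
  (hphi : admissible_objective cls phi)
  (gamma alpha_max alpha0 : R) (x0 : 'rV[R]_m)
  (F : nat -> set (set Omega))
  (X : nat -> Omega -> 'rV[R]_m) (A : nat -> Omega -> R)
  (s : nat -> R -> Omega -> 'rV[R]_m) (success : nat -> set Omega)
  (halg : adaptive_algorithm gamma alpha_max x0 alpha0 F X A s success)
  (eps : R) (heps : 0 < eps)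
  (T_eps : Omega -> \bar R)
  (hT_eps : T_eps = first_time R (optimality_condition cls phi eps) X)
  (hT_stop : stopping_time F T_eps)
  (alpha_bar p q : R)
  (halpha_bar : 0 < alpha_bar) (hp : 1 / 2 < p < 1) (hq : q = 1 - p)
  (halpha0 : alpha_bar <= alpha0)
  (step_i : step_size_dynamics gamma alpha_max A)
  (step_ii : step_size_increase P F gamma alpha_bar p A T_eps)
  (n : nat) (hn : (0 < n)%N) (omega : R) (homega : 0 < omega) :
  let c := 2 * Num.sqrt (p * q) / (1 - 2 * Num.sqrt (p * q)) ^+ 2 in
  ((1 - n%:R `^ (- omega) - c * n%:R `^ (- (1 + omega)))%:E <=
    P [set w | (T_eps w < n%:R%:E)%E \/
               (alpha_star alpha_bar gamma q omega n <=
                 \big[Num.min/A 1%N w]_(1 <= k < n.+1) A k w)%R])%E /\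
  alpha_star alpha_bar gamma q omega n =
    alpha_bar * gamma *
      n%:R `^ (- ((1 + omega) * log_base (1 / (2 * q)) (1 / gamma))).
Proof.
move=> c; have [gamma01 amax0 a00 Ffilt _ Aad _ Ainit _ _] := halg.
have [g0 g1] := andP gamma01; have [p12 p1] := andP hp.
have [Fsig Fm _] := Ffilt.
split; last exact: alpha_starE.
set a := alpha_star _ _ _ _ _; set Good := [set w | _].
have q0 : 0 < q by rewrite hq; lra.
have n1 : 1 <= n%:R :> R by rewrite ler1n.
have n0 : 0 < n%:R :> R by rewrite ltr0n.
have b1 : 1 < 1 / (2 * q) by rewrite ltr_pdivlMr; rewrite hq; lra.
pose L := (1 + omega) * log_base (1 / (2 * q)) n%:R.
have L0 : 0 <= L.
  by rewrite mulr_ge0 ?divr_ge0 ?ln_ge0 ?(ltW b1)// addr_ge0// ltW.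
have gL1 : gamma `^ L <= 1.
  by rewrite -(powRr0 gamma) ger_powR// g0 ltW.
have a_gt0 : 0 < a by rewrite !mulr_gt0 ?powR_gt0.
have a_le : a <= alpha0.
  apply: le_trans halpha0; rewrite /a /alpha_star -/L -mulrA.
  by rewrite ler_piMr ?(ltW halpha_bar)// mulr_ile1 ?powR_ge0 ?(ltW g0) ?(ltW g1).
have alpha0_range : alpha_bar <= alpha0 <= alpha_max.
  by rewrite halpha0; case/andP: a00.
have r1 := odds_gt1 hp hq.
pose C := \big[setU/set0]_(k < n) crossing (A := A) (T := T_eps) a k.
have mC : measurable C.
  apply: bigsetU_measurable => k _.
  exact: measurable_crossing Ffilt Aad hT_stop a k.
have GoodE : Good = [set w | (T_eps w <= n.-1%:R%:E)%E] `|`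
    \bigcap_(k in [set k | (0 < k <= n)%N]) [set w | a <= A k w].
  apply/seteqP; split=> w [Tw|mw].
  - by left; rewrite /= hT_eps -first_time_ltS prednK// -hT_eps.
  - by right=> k; move: k; apply/le_bigmin_natP.
  - by left; rewrite hT_eps -[n](prednK hn) first_time_ltS -hT_eps.
  - by right; apply/le_bigmin_natP.
have mGood : measurable Good.
  rewrite GoodE; apply: measurableU; first exact: Fm (hT_stop _).
  apply: bigcap_measurable => [|k _]; first by exists 1%N => /=; rewrite hn.
  rewrite (_ : [set _ | _] = A k @^-1` `[a, +oo[).
    by apply: (Fm k); exact: Aad.
  by apply/seteqP; split=> w /=; rewrite in_itv/= andbT.
have CGood : ~` C `<=` Good.
  move=> w nC; have [Tn|nT] := ltP (T_eps w) n%:R%:E; first by left.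
  right; apply/le_bigmin_natP => // k /andP[_].
  exact: (step_size_ge_of_no_crossing Ainit a n w a_le nT nC).
apply: (@le_trans _ _ (P (~` C))); last first.
  by rewrite le_measure ?inE//; exact: measurableC.
rewrite probability_setC//.
have := probability_crossing_le gamma01 amax0 Ffilt Aad hT_stop halpha_bar hp hq
  Ainit alpha0_range step_i step_ii a n a_gt0.
rewrite -/C -[P C]fineK ?fin_num_measure// -EFinM -EFinB !lee_fin.
move: (fine (P C)) (fine_ge0 (measure_ge0 P C)) => x x_ge0.
have -> : potential gamma alpha_bar (p / q) a = (p / q) `^ L * (p / q).
  rewrite /a /alpha_star -/L [_ * gamma `^ L]mulrC.
  rewrite (potential_mul gamma01 halpha_bar r1) ?mulr_gt0//.
  by rewrite [alpha_bar * _]mulrC (potential_down gamma01 halpha_bar r1)//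
    (potential_bar halpha_bar) mulr1.
(* The crossings are shown below to have probability at most [n] to the power [- omega];
   nonnegativity of the [c] term then gives the stated bound. *)
have c0 : 0 <= c * n%:R `^ (- (1 + omega)).
  by rewrite mulr_ge0 ?powR_ge0// divr_ge0 ?sqr_ge0// mulr_ge0// sqrtr_ge0.
have b_le : 1 / (2 * q) <= p / q.
  rewrite (_ : 1 / (2 * q) = 1 / 2 / q); last by field; rewrite gt_eqF.
  by rewrite ler_pM2r ?invr_gt0// ltW.
(* Since [L >= 0], the base [p / q] may be lowered to [1 / (2 * q)], whose power [L] is exactly [n]
   to the power [1 + omega]. *)
have nL : n%:R * n%:R `^ omega <= (p / q) `^ L.
  rewrite -{1}[n%:R]powRr1 ?ler0n// -powRD; last by rewrite gt_eqF ?addr_gt0.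
  rewrite -(powR_log_base _ (1 / (2 * q))) ?gt_eqF ?(lt_trans ltr01 b1)//.
  by apply: ge0_ler_powR => //; rewrite nnegrE; lra.
move: r1 nL; move: (p / q) => r r1; move: (r `^ L) => rL nL h.
have o0 : 0 < n%:R `^ omega :> R by rewrite powR_gt0.
suff : x <= n%:R `^ (- omega) by lra.
(* After multiplication by [n * r] the goal follows from [rL * r * x <= 1 + n * (r - 1) <= n * r],
   the last by [1 <= n]. The single factor [gamma] in [alpha_star] supplies the extra [r] on the
   left. *)
rewrite powRN -[leRHS]mul1r ler_pdivlMr// -(@ler_pM2l _ n%:R)//.
rewrite mulr1 -(@ler_pM2r _ r) ?(lt_trans ltr01)//.
have : n%:R * n%:R `^ omega * x * r <= rL * x * r.
  by rewrite ler_wpM2r ?(ltW (lt_trans ltr01 r1))// ler_wpM2r.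
nra.
Qed.
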